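(* Let $p(\cdot), q(\cdot) \in \mathbb{P}_{0}(0,\infty)$ be such that $q(0)\le p(0)$ and $p(\infty)\le q(\infty)$. Then, for every $f\in\mathfrak{L}^{p(\cdot),q(\cdot)}(\mathbb{R}^n)$, \[ \| f\chi_{E_j}\|_{\mathfrak{L}^{p(\cdot),q(\cdot)}}\downarrow 0 \quad (j\to\infty) \] whenever $\{E_j\}_{j=1}^{\infty}$ is a sequence of measurable subsets of $\mathbb{R}^n$ satisfying $E_j\supset E_{j+1}$ for all $j\in\mathbb{N}$ and $\bigcap_{j=1}^{\infty}E_j=\emptyset$.
   Context: A variable exponent on $(0,\infty)$ is a measurable function $p(\cdot):(0,\infty)\to(0,\infty)$; put $p_{-}=\operatorname{ess\,inf}_{t\in(0,\infty)}p(t)$ and $p_{+}=\operatorname{ess\,sup}_{t\in(0,\infty)}p(t)$. $\mathbb{P}_0(0,\infty)$ is the class of variable exponents with $0<p_{-}\le p_{+}<\infty$ for which the limits $p(0)=\lim_{t\to0^+}p(t)$ and $p(\infty)=\lim_{t\to\infty}p(t)$ exist and, for some constant $C>0$, $|p(t)-p(0)|\le \frac{C}{-\log t}$ for $0<t<\frac12$ and $|p(t)-p(\infty)|\le\frac{C}{\log(e+t)}$ for $0<t<\infty$. For measurable $f$ on $\mathbb{R}^n$, the non-increasing rearrangement is $f^{*}(t)=\inf\{s\ge 0: |\{x\in\mathbb{R}^n:|f(x)|>s\}|\le t\}$, $0<t<\infty$. Put $\rho_{p(\cdot),q(\cdot)}(f)=\int_0^\infty t^{\frac{q(t)}{p(t)}-1}[f^{*}(t)]^{q(t)}\,dt$.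 The variable Lorentz space $\mathfrak{L}^{p(\cdot),q(\cdot)}(\mathbb{R}^n)$ is the set of measurable $f$ with $\rho_{p(\cdot),q(\cdot)}(f)<\infty$, equipped with $\|f\|_{\mathfrak{L}^{p(\cdot),q(\cdot)}}=\inf\{\lambda>0:\rho_{p(\cdot),q(\cdot)}(f/\lambda)\le 1\}$. $\chi_E$ denotes the characteristic function of $E$. *)

(* Defs.v *)
From HB Require Import structures.
From mathcomp Require Import all_boot all_order all_algebra.
From mathcomp Require Import all_classical all_reals all_analysis ess_sup_inf.
From mathcomp Require Import complex.

Set Implicit Arguments.
Unset Strict Implicit.
Unset Printing Implicit Defensive.

Import Order.TTheory GRing.Theory Num.Theory.
Import numFieldNormedType.Exports.

Local Open Scope classical_set_scope.
Local Open Scope ring_scope.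

Section lebesgue_Rn.
Context (R : realType) (n : nat).
Local Open Scope ereal_scope.
Implicit Types (c : 'rV[R]_n.+1 * 'rV[R]_n.+1) (A : set 'rV[R]_n.+1).

Definition box c : set 'rV[R]_n.+1 :=
  [set x | forall i, (c.1 ord0 i < x ord0 i <= c.2 ord0 i)%R].

(* Meaningful only when c.1 <= c.2 coordinatewise, as box_cover requires. *)
Definition box_volume c : \bar R :=
  (\prod_(i < n.+1) (c.2 ord0 i - c.1 ord0 i))%R%:E.

Definition box_cover A :=
  [set F : ('rV[R]_n.+1 * 'rV[R]_n.+1)^nat |
    (forall k i, ((F k).1 ord0 i <= (F k).2 ord0 i)%R) /\
    A `<=` \bigcup_k box (F k)].

Definition lebesgue_outer A : \bar R :=
  ereal_inf [set \sum_(k <oo) box_volume (F k) | F in box_cover A].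

Lemma box_volume_ge0 A F k : box_cover A F -> 0 <= box_volume (F k).
Proof.
move=> [Fle _]; rewrite lee_fin; apply: prodr_ge0 => i _.
by rewrite subr_ge0.
Qed.

Lemma lebesgue_outer_ge0 A : 0 <= lebesgue_outer A.
Proof.
apply: le_ereal_inf_tmp => _ [F AF <-].
by apply: nneseries_ge0 => k _ _; exact: box_volume_ge0 AF.
Qed.

Lemma lebesgue_outer0 : lebesgue_outer set0 = 0.
Proof.
apply/eqP; rewrite eq_le lebesgue_outer_ge0 andbT.
apply: ereal_inf_lbound; exists (fun=> (0%R, 0%R)); first by split.
rewrite eseries0// => k _ _ /=.
by rewrite /box_volume big_ord_recl/= subrr mul0r.
Qed.

Lemma le_lebesgue_outer :
  {homo lebesgue_outer : A B / A `<=` B >-> A <= B}.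
Proof.
move=> A B AB; apply/ereal_inf_le_tmp => _ [F [Fle BF] <-].
by exists F => //; split => //; exact: subset_trans AB BF.
Qed.

Lemma lebesgue_outer_sigma_subadditive : sigma_subadditive lebesgue_outer.
Proof.
move=> A; have [[i ioo]|] := pselect (exists i, lebesgue_outer (A i) = +oo).
  rewrite (eseries_pinfty _ _ ioo) ?leey// => k _.
  by rewrite -ltNye (lt_le_trans _ (lebesgue_outer_ge0 _)).
rewrite -forallNE => Aoo.
apply/lee_addgt0Pr => e e0.
apply: le_trans (epsilon_trick _ _ (ltW e0)); last first.
  by move=> k; exact: lebesgue_outer_ge0.
pose P k F := box_cover (A k) F /\
  \sum_(j <oo) box_volume (F j) <=
    lebesgue_outer (A k) + (e / (2 ^ k.+1)%:R)%:E.
have [G PG] : {G & forall k, P k (G k)}.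
  apply: (@choice _ _ P) => k; rewrite /P /lebesgue_outer.
  have e1 : (0 < e / (2 ^ k.+1)%:R)%R.
    by rewrite divr_gt0// ltr0n expn_gt0.
  have Afin : lebesgue_outer (A k) \is a fin_num.
    by rewrite ge0_fin_numE ?lebesgue_outer_ge0// ltey; apply/eqP; exact: Aoo.
  have [_ [F AF <-] /ltW lt] := lb_ereal_inf_adherent e1 Afin.
  by exists F.
have G0 x : 0 <= (box_volume \o uncurry G) x.
  by case: x => i j /=; apply: box_volume_ge0 (PG i).1.
apply: (@le_trans _ _ (\esum_(i in setT) (box_volume \o uncurry G) i)).
  have /card_esym/ppcard_eqP[f] := card_nat2.
  apply: ereal_inf_lbound => /=; exists (uncurry G \o f).
    split=> [k|x [i _] /(PG i).1.2[j _ Gx]] /=.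
      by case: (f k) => i j /=; exact: (PG i).1.1.
    by exists (f^-1%FUN (i, j)) => //=; rewrite invK ?inE.
  rewrite -(esum_pred_image (box_volume \o uncurry G) _ xpredT)
    ?[fun=> _]set_true//.
  by rewrite image_eq.
rewrite (_ : esum _ _ = \sum_(i <oo) \sum_(j <oo) box_volume (G i j)).
  apply: lee_nneseries => [i _ _|i _]; last exact: (PG i).2.
  by apply: nneseries_ge0 => j _ _; exact: (G0 (i, j)).
pose J : nat -> set (nat * nat) := fun i => [set (i, j) | j in setT].
rewrite (_ : setT = \bigcup_k J k); last first.
  by rewrite predeqE => -[a b]; split => // _; exists a => //; exists b.
rewrite esum_bigcupT /=; last 2 first.
  - apply/trivIsetP => i j _ _ ij.
    rewrite predeqE => -[k m] /=; split => //= -[] [_] _ [<-{k} _].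
    by move=> [m' _] [] /esym/eqP; rewrite (negbTE ij).
  - by move=> x; exact: G0.
rewrite -(image_id [set: nat]) -fun_true esum_pred_image//; last first.
  by move=> k _; apply: esum_ge0 => x _; exact: G0.
apply: eq_eseriesr => /= j _.
rewrite -(esum_pred_image (box_volume \o uncurry G) (pair j) predT)//=.
- by congr esum; rewrite predeqE => -[a b]; split; move=> [i _ <-]; exists i.
- by move=> i _; exact: (G0 (j, i)).
- by move=> ? ? _ _; exact: (@can_inj _ _ _ snd).
Qed.

HB.instance Definition _ := isOuterMeasure.Build R 'rV[R]_n.+1 lebesgue_outer
  lebesgue_outer0 lebesgue_outer_ge0 le_lebesgue_outer
  lebesgue_outer_sigma_subadditive.

End lebesgue_Rn.

(* Caratheodory's construction from the outer measure given by countable covers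
   by boxes: R^n.+1 with its Lebesgue (not merely Borel) sigma-algebra.
   Writing the dimension n.+1 excludes R^0, whose only box is never empty. *)
Definition Rn (R : realType) (n : nat) : Type :=
  caratheodory_type (@lebesgue_outer R n).
HB.instance Definition _ (R : realType) (n : nat) :=
  Measurable.copy (Rn R n) (caratheodory_type (@lebesgue_outer R n)).

Definition lebesgue_Rn (R : realType) (n : nat) : set (Rn R n) -> \bar R :=
  @lebesgue_outer R n.
HB.instance Definition _ (R : realType) (n : nat) :=
  isMeasure.Build _ (Rn R n) R (@lebesgue_Rn R n)
    (caratheodory_measure0 (@lebesgue_outer R n))
    (caratheodory_measure_ge0 (mu := @lebesgue_outer R n))
    (caratheodory_measure_sigma_additive (mu := @lebesgue_outer R n)).

(* The real line with its Lebesgue sigma-algebra, i.e. the domain of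
   completed_lebesgue_measure. *)
Definition Rleb (R : realType) : Type :=
  caratheodory_type (@wlength R idfun)^*%mu.
HB.instance Definition _ (R : realType) :=
  Measurable.copy (Rleb R) (caratheodory_type (@wlength R idfun)^*%mu).

Definition lebesgue_R (R : realType) : set (Rleb R) -> \bar R :=
  @completed_lebesgue_measure R.
HB.instance Definition _ (R : realType) :=
  Measure.copy (@lebesgue_R R) (@completed_lebesgue_measure R).

Definition half_line (R : realType) : set (Rleb R) :=
  (`]0%R, +oo[%classic : set R).

Lemma measurable_half_line (R : realType) : measurable (@half_line R).
Proof. by apply: sub_caratheodory; exact: measurable_itv. Qed.

Section exponents.
Context (R : realType).
Implicit Type p : R -> R.
Local Notation half_measure := (mrestr (@lebesgue_R R) (@measurable_half_line R)).

(* Exponents are total functions on R; only their values on (0, +oo) matter. *)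
Definition variable_exponent p : Prop :=
  measurable_fun (@half_line R) (p : Rleb R -> R) /\
  forall t, 0 < t -> 0 < p t.

Definition exponent_inf p : \bar R :=
  ess_inf half_measure (EFin \o p : Rleb R -> \bar R).

Definition exponent_sup p : \bar R :=
  ess_sup half_measure (EFin \o p : Rleb R -> \bar R).

Definition exponent_at0 p : R := lim (p t @[t --> 0^'+]).

Definition exponent_aty p : R := lim (p t @[t --> +oo]).

Record exponent_P0 p : Prop := ExponentP0 {
  P0_exponent : variable_exponent p;
  P0_bounds : [/\ (0 < exponent_inf p)%E, (exponent_inf p <= exponent_sup p)%E
                & (exponent_sup p < +oo)%E];
  P0_cvg0 : cvg (p t @[t --> 0^'+]);
  P0_cvgy : cvg (p t @[t --> +oo]);
  P0_log_holder : exists2 C : R, 0 < C &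
    (forall t, 0 < t -> t < 2^-1 ->
       `|p t - exponent_at0 p| <= C / (- ln t)) /\
    (forall t, 0 < t ->
       `|p t - exponent_aty p| <= C / ln (expR 1 + t)) }.

End exponents.

Section variable_lorentz.
Context (R : realType) (n : nat).
Implicit Types (f : Rn R n -> R[i]) (p q : R -> R).

(* Functions are complex-valued; R has its Borel sigma-algebra here. *)
Definition measurable_complex f : Prop :=
  measurable_fun setT (fun x => complex.Re (f x)) /\
  measurable_fun setT (fun x => complex.Im (f x)).

(* +oo when no level s is admissible. The order on R[i] compares real numbers
   only, so s%:C < `|z| says that s is smaller than the modulus of z. *)
Definition rearrangement f (t : R) : \bar R :=
  ereal_inf [set s%:E | s in [set s : R | 0 <= s /\
    (lebesgue_Rn [set x | ((s%:C)%C < `|f x|)%R] <= t%:E)%E]].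

Definition lorentz_modular p q f : \bar R :=
  (\int[@lebesgue_R R]_(t in @half_line R)
     (((t : R) `^ (q t / p t - 1))%:E * poweR (rearrangement f t) (q t)))%E.

Definition lorentz_space p q : set (Rn R n -> R[i]) :=
  [set f | measurable_complex f /\ (lorentz_modular p q f < +oo)%E].

Definition lorentz_norm p q f : \bar R :=
  ereal_inf [set l%:E | l in [set l : R | 0 < l /\
    (lorentz_modular p q (fun x => f x / (l%:C)%C)%R <= 1)%E]].

End variable_lorentz.

(* Main.v *)
(* Since q is bounded, a modular finite for f stays finite, up to a constant
   factor, for f / l; so it suffices that the modular of f chi_(E_j) tends to 0,
   and this is dominated convergence under the integrand of f. For pointwise
   convergence one needs (f chi_(E_j))^*(t) -> 0, which is continuity from above
   of Lebesgue measure once every level set {|f| > s}, s > 0, has finite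
   measure. That finiteness is where p(oo) <= q(oo) enters: with the logarithmic
   decay condition it gives q(t)/p(t) - 1 >= - K / log(e + t) for large t, so the
   weight t^(q/p-1) is bounded below near infinity, and a rearrangement bounded
   below by a positive constant would have infinite modular. *)
Require Import Defs.
From mathcomp Require Import all_boot all_order all_algebra.
From mathcomp Require Import all_classical all_reals all_analysis.
From mathcomp Require Import ess_sup_inf measurable_realfun.
From mathcomp Require Import complex.
From mathcomp Require Import ring lra.

Set Implicit Arguments.
Unset Strict Implicit.
Unset Printing Implicit Defensive.

Import Order.TTheory GRing.Theory Num.Theory.
Import numFieldNormedType.Exports.

Local Open Scope classical_set_scope.
Local Open Scope ring_scope.

(** * Extended-real limits and measurability of variable powers *)

Lemma cvge0_squeeze (R : realType) (u : (\bar R)^nat) :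
  (forall j, (0 <= u j)%E) ->
  (forall e : R, 0 < e -> \forall j \near \oo, (u j <= e%:E)%E) ->
  u @ \oo --> 0%E.
Proof.
move=> u0 ue; apply/fine_cvgP; split.
  (* Any fixed tolerance gives eventual finiteness; [1] is taken. *)
  near=> j; rewrite ge0_fin_numE//.
  apply: (@le_lt_trans _ _ 1%:E); last exact: ltry.
  by near: j; exact: ue.
apply/cvgr0Pnorm_le => e e0; near=> j.
have uje : (u j <= e%:E)%E by near: j; exact: ue.
rewrite /= ger0_norm ?fine_ge0//.
by rewrite -lee_fin fineK// ge0_fin_numE// (le_lt_trans uje)// ltry.
Unshelve. all: by end_near. Qed.

Section measurable_power.
Context d (T : measurableType d) (R : realType).
Variables (D : set T) (mD : measurable D).

Lemma measurable_fun_powR (a b : T -> R) :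
  measurable_fun D a -> measurable_fun D b ->
  measurable_fun D (fun t => a t `^ b t).
Proof.
move=> ma mb; rewrite /powR.
apply: measurable_fun_if => //.
- exact: measurable_fun_eqr.
- apply: (measurable_funS mD (@subIsetl _ _ _)).
  rewrite (_ : (fun t => _) = (fun t => if b t == 0 then 1 else 0)); last first.
    by apply/funext => t; case: (b t == 0).
  by apply: measurable_fun_if => //; exact: measurable_fun_eqr.
- apply: (measurable_funS mD (@subIsetl _ _ _)).
  apply: measurableT_comp => //; apply: measurable_funM => //.
  exact: measurableT_comp.
Qed.

Lemma measurable_fun_poweR (a : T -> \bar R) (b : T -> R) :
  measurable_fun D a -> measurable_fun D b ->
  (forall t, D t -> 0 < b t) ->
  measurable_fun D (fun t => poweR (a t) (b t)).
Proof.
move=> ma mb b0.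
(* A positive exponent rules out the case of exponent zero, so [poweR] is constant on each of the
   sets where [a] is infinite. *)
apply: (@eq_measurable_fun _ _ _ _ D (fun t => if a t == +oo%E then +oo%E
  else if a t == -oo%E then 0%E else (fine (a t) `^ b t)%:E)).
  by move=> t /set_mem/b0 bt0; rewrite poweRE (gt_eqF bt0).
apply: measurable_fun_if => //.
- exact: measurable_fun_eqe.
- apply: (measurable_funS mD (@subIsetl _ _ _)).
  apply: measurable_fun_if => //.
  + exact: measurable_fun_eqe.
  + apply: (measurable_funS mD (@subIsetl _ _ _)).
    apply/measurable_EFinP; apply: measurable_fun_powR => //.
    exact: measurableT_comp.
Qed.

End measurable_power.

(** * Lebesgue measurability on the line *)

Section Rleb.
Context (R : realType).

Lemma measurable_Rleb (A : set R) : measurable A ->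
  measurable (A : set (Rleb R)).
Proof. exact: sub_caratheodory. Qed.

Lemma lebesgue_R_itvcy (a : R) : lebesgue_R (`[a, +oo[ : set R) = +oo%E.
Proof.
rewrite (_ : lebesgue_R _ = lebesgue_measure (`[a, +oo[ : set R))//.
by rewrite lebesgue_measure_itv/= ltry.
Qed.

Lemma measurable_id_Rleb (D : set (Rleb R)) :
  measurable_fun D (fun t : Rleb R => t : R).
Proof. by move=> mD B mB; apply: measurableI => //; exact: measurable_Rleb. Qed.

(** The set where a monotone function exceeds a given level is an interval, hence Borel, and such
    sets generate. *)
Lemma nonincreasing_emeasurable (g : Rleb R -> \bar R) (D : set (Rleb R)) :
  (forall t u : R, t <= u -> (g u <= g t)%E) -> measurable_fun D g.
Proof.
move=> gni mD.
apply: (measurability (@ErealGenOInfty.G R)) => //.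
  exact: ErealGenOInfty.measurableE.
move=> /= _ [_ [r ->] <-].
apply: measurableI => //; apply: measurable_Rleb.
apply: is_interval_measurable => s t/=.
rewrite !in_itv/= !andbT => fs ft u /andP[su ut].
by rewrite in_itv/= andbT (lt_le_trans ft)// gni.
Qed.

Lemma half_lineP (t : R) : @half_line R t <-> 0 < t.
Proof. by rewrite /half_line/= in_itv/= andbT. Qed.

End Rleb.

(** * Bounds on exponents and on the weight near infinity *)

Section exponent.
Context (R : realType).
Implicit Type p : R -> R.

Lemma ln_expR1D_ge1 (t : R) : 0 < t -> 1 <= ln (expR 1 + t).
Proof.
move=> t0; rewrite -[leLHS](@expRK R) ler_ln ?posrE ?expR_gt0//.
  by rewrite lerDl ltW.
by rewrite addr_gt0// expR_gt0.
Qed.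

(* The decay condition at infinity is imposed on all of (0, +oo), so it bounds
   the exponent pointwise and not only almost everywhere. *)
Lemma exponent_bounded p : exponent_P0 p ->
  exists2 Q, 0 < Q & forall t, 0 < t -> p t <= Q.
Proof.
move=> [[mp p0] _ _ _ [C C0 [_ pC]]].
have pQ t : 0 < t -> p t <= exponent_aty p + C.
  move=> t0; have := pC _ t0; have L1 := ln_expR1D_ge1 t0.
  rewrite ler_distl => /andP[_ /le_trans]; apply.
  rewrite lerD2l ler_pdivrMr ?(lt_le_trans _ L1)//.
  by rewrite ler_peMr// ltW.
exists (exponent_aty p + C) => //.
exact: lt_le_trans (p0 _ ltr01) (pQ _ ltr01).
Qed.

(** The essential infimum dominates some real [a > 0]. A limit below [a] would keep [p] below [a] on
    a whole ray, which has infinite measure, whereas the points with [p t < a] form a null set. *)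
Lemma exponent_aty_gt0 p : exponent_P0 p -> 0 < exponent_aty p.
Proof.
move=> [_ [pinf _ _] _ cvgy _].
have [a a0 ap] : exists2 a : R, 0 < a & (a%:E <= exponent_inf p)%E.
  case: (exponent_inf p) pinf => [a| |]// a0.
    by exists a; rewrite -?lte_fin.
  by exists 1 => //; rewrite leey.
have /= [N [mN N0 subN]] := ess_inf_le
  (mrestr (@lebesgue_R R) (@measurable_half_line R))
  (EFin \o p : Rleb R -> \bar R).
apply: (lt_le_trans a0); rewrite leNgt; apply/negP => lta.
have [M [_ HM]] : \forall t \near +oo, p t < a by exact: (cvgr_lt _ cvgy _ lta).
pose M1 := Num.max M 0 + 1.
have MM1 t : M1 <= t -> M < t /\ 0 < t.
  move=> M1t; have : Num.max M 0 < t by apply: lt_le_trans M1t; rewrite ltrDl.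
  by rewrite gt_max => /andP[].
(* The ray falls inside the exceptional set [N], whose trace on the half-line is null. *)
have : (lebesgue_R (`[M1, +oo[ : set R) <=
    lebesgue_R ((N : set R) `&` @half_line R))%E.
  apply: le_measure; rewrite ?inE.
  - exact: measurable_Rleb.
  - by apply: measurableI => //; exact: measurable_half_line.
  - move=> t; rewrite /= in_itv/= andbT => /MM1[Mt t0]; split; last first.
      by rewrite /half_line/= in_itv/= t0.
    apply: subN => /=; apply/negP; rewrite -ltNge.
    by apply: lt_le_trans ap; rewrite lte_fin; exact: HM.
by rewrite lebesgue_R_itvcy (_ : lebesgue_R (_ `&` _) = 0%E)//.
Qed.

(** With [L = ln (expR 1 + t)], the decay conditions and the order of the limits give
    [q t - p t >= - (Cp + Cq) / L]. Since [0 <= ln t <= L] for [t >= 1], multiplying by [ln t]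
    leaves a bound independent of [t], and dividing by [p t] is harmless once [p t] stays away from
    zero. *)
Lemma weight_bounded_below p q : exponent_P0 p -> exponent_P0 q ->
  exponent_aty p <= exponent_aty q ->
  exists M c : R, [/\ 0 < M, 0 < c &
    forall t, M <= t -> c <= t `^ (q t / p t - 1)].
Proof.
move=> hp hq.
have := exponent_aty_gt0 hp; set P := exponent_aty p => P0 pq.
have [Cp Cp0 [_ pC]] := P0_log_holder hp.
have [Cq Cq0 [_ qC]] := P0_log_holder hq.
have P2 : P / 2 < P by rewrite ltr_pdivrMr// ltr_pMr// ltr1n.
have [M [_ HM]] : \forall t \near +oo, P / 2 < p t.
  exact: (cvgr_gt _ (P0_cvgy hp) _ P2).
(* Beyond the first witness both [p t > P / 2] and [ln t >= 0] hold; the second is the exponential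
   of the resulting lower bound for [(q t / p t - 1) * ln t]. *)
exists (Num.max M 1 + 1), (expR (- ((Cp + Cq) / (P / 2)))).
split; [by rewrite ltr_wpDl// le_max ler01 orbT|exact: expR_gt0|].
move=> t Mt.
have : Num.max M 1 < t by apply: lt_le_trans Mt; rewrite ltrDl.
rewrite gt_max => /andP[{}/HM pt t1].
have t0 : 0 < t by exact: lt_trans t1.
rewrite /powR gt_eqF// ler_expR.
have p0 : 0 < p t by apply: lt_trans pt; rewrite divr_gt0.
have lnt0 : 0 <= ln t by rewrite ln_ge0// ltW.
have L1 := ln_expR1D_ge1 t0.
have lntL : ln t <= ln (expR 1 + t).
  by rewrite ler_ln ?posrE ?lerDr ?expR_ge0// addr_gt0// expR_gt0.
move: L1 lntL (pC _ t0) (qC _ t0); set L := ln (_ + _) => L1 lntL.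
have L0 : 0 < L by exact: lt_le_trans L1.
rewrite !ler_distl -/P => /andP[_ pP] /andP[qQ _].
have qp : - ((Cp + Cq) / L) <= q t - p t by rewrite mulrDl; lra.
have : - (Cp + Cq) <= (q t - p t) * ln t.
  have : - ((Cp + Cq) / L) * ln t <= (q t - p t) * ln t by exact: ler_wpM2r.
  apply: le_trans; rewrite mulNr lerN2 mulrAC -mulrA.
  apply: ler_piMr; first by rewrite addr_ge0// ltW.
  by rewrite ler_pdivrMr// mul1r.
have -> : (q t / p t - 1) * ln t = (q t - p t) * ln t / p t.
  by field; rewrite gt_eqF.
move=> h; rewrite ler_pdivlMr//; apply: le_trans h.
rewrite mulNr lerN2 -mulrA; apply: ler_peMr; first by rewrite addr_ge0// ltW.
by rewrite ler_pdivlMl ?mulr1 ?divr_gt0// ltW.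
Qed.

End exponent.

(** * Level sets and the rearrangement *)

Section rearrangement.
Context (R : realType) (n : nat).
Implicit Types (f g : Rn R n -> R[i]) (s t l : R).

Definition level_set f s : set (Rn R n) := [set x | ((s%:C)%C < `|f x|)%R].

Lemma measurable_level_set f s : measurable_complex f ->
  measurable (level_set f s).
Proof.
move=> [mRe mIm].
have mnorm : measurable_fun setT
    (fun x => Num.sqrt (complex.Re (f x) ^+ 2 + complex.Im (f x) ^+ 2)).
  apply: (@measurableT_comp _ _ _ _ _ _ (@Num.sqrt R)).
    exact: continuous_measurable_fun (@sqrt_continuous R).
  by apply: measurable_funD; exact: measurable_funX.
rewrite (_ : level_set f s = setT `&` (fun x => Num.sqrt
    (complex.Re (f x) ^+ 2 + complex.Im (f x) ^+ 2)) @^-1` `]s, +oo[).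
  exact: mnorm.
apply/seteqP; split => x; rewrite /level_set/= normc_def ltcR in_itv/= andbT//.
by case.
Qed.

Lemma level_set_anti f s s' : s <= s' -> level_set f s' `<=` level_set f s.
Proof. by move=> ss' x; apply: le_lt_trans; rewrite lecR. Qed.

Lemma le_lebesgue_Rn (A B : set (Rn R n)) : A `<=` B ->
  (lebesgue_Rn A <= lebesgue_Rn B)%E.
Proof. exact: le_lebesgue_outer. Qed.

Lemma rearrangement_ge0 f t : (0 <= rearrangement f t)%E.
Proof. by apply: le_ereal_inf_tmp => _ [s [s0 _] <-]; rewrite lee_fin. Qed.

Lemma rearrangement_le f s t : 0 <= s ->
  (lebesgue_Rn (level_set f s) <= t%:E)%E ->
  (rearrangement f t <= s%:E)%E.
Proof. by move=> s0 fst; apply: ereal_inf_lbound; exists s. Qed.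

(** An admissible level below [s] would have a level set containing that of [s], hence of measure
    above [t]. *)
Lemma rearrangement_ge f s t : (t%:E < lebesgue_Rn (level_set f s))%E ->
  (s%:E <= rearrangement f t)%E.
Proof.
move=> ts; apply: le_ereal_inf_tmp => _ [u [u0 fut] <-].
rewrite lee_fin leNgt; apply/negP => /ltW us.
have := le_lt_trans (le_trans (le_lebesgue_Rn (level_set_anti us)) fut) ts.
by rewrite ltxx.
Qed.

Lemma rearrangement_nonincreasing f t u : t <= u ->
  (rearrangement f u <= rearrangement f t)%E.
Proof.
move=> tu; apply: ereal_inf_le_tmp => _ [s [s0 fst] <-]; exists s => //.
by split => //; apply: le_trans fst _; rewrite lee_fin.
Qed.

Lemma le_rearrangement f g t : (forall x, `|f x| <= `|g x|) ->
  (rearrangement f t <= rearrangement g t)%E.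
Proof.
move=> fg; apply: ereal_inf_le_tmp => _ [s [s0 gst] <-]; exists s => //.
split => //; apply: le_trans gst; apply: le_lebesgue_Rn => x /=.
by move=> /lt_le_trans; exact.
Qed.

(** If [s] is admissible for [f], then [l^-1 * s] is admissible for the quotient, whose level set
    there is the same. *)
Lemma rearrangement_div f l t : 0 < l ->
  (rearrangement (fun x => f x / (l%:C)%C)%R t <=
    l^-1%:E * rearrangement f t)%E.
Proof.
move=> l0; rewrite lee_pdivlMl//; apply: le_ereal_inf_tmp => _ [s [s0 fst] <-].
rewrite -lee_pdivlMl// -EFinM; apply: rearrangement_le.
  by rewrite mulr_ge0// invr_ge0 ltW.
apply: le_trans fst; apply: le_lebesgue_Rn => x; rewrite /level_set/=.
rewrite !normc_def !ltcR.
have -> : complex.Re (f x / (l%:C)%C) ^+ 2 + complex.Im (f x / (l%:C)%C) ^+ 2 =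
    l^-1 ^+ 2 * (complex.Re (f x) ^+ 2 + complex.Im (f x) ^+ 2).
  case: (f x) => a b /=; rewrite expr0n/= addr0.
  by field; rewrite gt_eqF.
rewrite sqrtrM ?sqr_ge0// sqrtr_sqr ger0_norm ?invr_ge0 ?ltW//.
by rewrite ltr_pM2l// invr_gt0.
Qed.

Lemma normr_mul_indic f (E : set (Rn R n)) x : `|f x * \1_E x| <= `|f x|.
Proof.
rewrite normrM ler_piMr// indicE; case: (x \in E); first by rewrite normr1.
by rewrite normr0.
Qed.

(** The sets [F j] decrease to the empty set inside a set of finite measure, so their measures
    eventually drop below [t], which makes [s] an admissible level. *)
Lemma rearrangement_indic_cvg0 f (E : (set (Rn R n))^nat) t :
  measurable_complex f ->
  (forall s, 0 < s -> (lebesgue_Rn (level_set f s) < +oo)%E) ->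
  (forall j, measurable (E j)) ->
  (forall i j, (i <= j)%N -> E j `<=` E i) ->
  \bigcap_j E j = set0 -> 0 < t ->
  forall s, 0 < s ->
  \forall j \near \oo,
    (rearrangement (fun x => f x * \1_(E j) x)%R t <= s%:E)%E.
Proof.
move=> mf fin mE decE capE t0 s s0.
pose F j := level_set f s `&` E j.
have mF j : measurable (F j).
  by apply: measurableI => //; exact: measurable_level_set.
have capF : \bigcap_j F j = set0.
  by rewrite -subset0 -capE => x Fx j _; exact: (Fx j I).2.
have : @lebesgue_Rn R n \o F @ \oo --> lebesgue_Rn (\bigcap_j F j).
  apply: nonincreasing_cvg_mu => //.
  - by apply: le_lt_trans (fin _ s0); apply: le_lebesgue_Rn; exact: subIsetl.
  - by rewrite capF.
  - by move=> i j ij; apply/subsetPset; apply: setIS; exact: decE.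
rewrite capF measure0 => /fine_cvgP[finF /cvgr_lt/(_ _ t0)] ltF.
near=> j; apply: rearrangement_le; first exact: ltW.
apply: (@le_trans _ _ (lebesgue_Rn (F j))).
  apply: le_lebesgue_Rn => x; rewrite /level_set/= => sfx; split.
    exact: lt_le_trans sfx (normr_mul_indic _ _ _).
  (* Off [E j] the product vanishes, and zero does not exceed the positive level [s]. *)
  move: sfx; rewrite indicE; case: (boolP (x \in E j)) => [/set_mem//|_].
  by rewrite mulr0 normr0 ltcR ltNge ltW.
have Fj : lebesgue_Rn (F j) \is a fin_num by near: j.
rewrite -(fineK Fj) lee_fin ltW//.
by near: j.
Unshelve. all: by end_near. Qed.

End rearrangement.

(** * The modular: scaling, finiteness of level sets, convergence *)

Section modular.
Context (R : realType) (n : nat) (p q : R -> R).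
Hypotheses (hp : exponent_P0 p) (hq : exponent_P0 q).
Implicit Types (f g : Rn R n -> R[i]) (s t l : R).

Let p_gt0 t : 0 < t -> 0 < p t. Proof. exact: (P0_exponent hp).2. Qed.
Let q_gt0 t : 0 < t -> 0 < q t. Proof. exact: (P0_exponent hq).2. Qed.

Definition lorentz_integrand f t : \bar R :=
  ((t `^ (q t / p t - 1))%:E * poweR (rearrangement f t) (q t))%E.

Lemma lorentz_integrand_ge0 f t : (0 <= lorentz_integrand f t)%E.
Proof. by rewrite mule_ge0 ?poweR_ge0// lee_fin powR_ge0. Qed.

Lemma measurable_lorentz_integrand f :
  measurable_fun (@half_line R) (lorentz_integrand f : Rleb R -> \bar R).
Proof.
have mH := @measurable_half_line R.
have mp := (P0_exponent hp).1; have mq := (P0_exponent hq).1.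
apply: emeasurable_funM.
  apply/measurable_EFinP; apply: (measurable_fun_powR mH).
    exact: measurable_id_Rleb.
  apply: measurable_funB; last exact: measurable_cst.
  apply: measurable_funM; first exact: mq.
  (* Writing the reciprocal as a power reduces its measurability to that of [powR]. *)
  apply: (@eq_measurable_fun _ _ _ _ _ (fun t : Rleb R => p t `^ (-1))).
    by move=> t /set_mem/half_lineP/p_gt0/ltW; exact: powR_inv1.
  exact: (measurable_fun_powR mH mp (measurable_cst _)).
apply: (measurable_fun_poweR mH _ mq); last by move=> t /half_lineP/q_gt0.
apply: nonincreasing_emeasurable => t u; exact: rearrangement_nonincreasing.
Qed.

Lemma lorentz_modularE f :
  lorentz_modular p q f =
  (\int[@lebesgue_R R]_(t in @half_line R) lorentz_integrand f t)%E.
Proof. by []. Qed.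

Lemma le_lorentz_integrand f g t : 0 < t -> (forall x, `|f x| <= `|g x|) ->
  (lorentz_integrand f t <= lorentz_integrand g t)%E.
Proof.
move=> t0 fg; apply: lee_wpmul2l; first by rewrite lee_fin powR_ge0.
apply: gt0_ler_poweR; rewrite ?in_itv/= ?rearrangement_ge0 ?leey//.
- exact/ltW/q_gt0.
- exact: le_rearrangement.
Qed.

Lemma le_lorentz_modular f g : (forall x, `|f x| <= `|g x|) ->
  (lorentz_modular p q f <= lorentz_modular p q g)%E.
Proof.
move=> fg; apply: ge0_le_integral.
- exact: measurable_half_line.
- by move=> t _; exact: lorentz_integrand_ge0.
- exact: measurable_lorentz_integrand.
- exact: measurable_lorentz_integrand.
- by move=> t /half_lineP t0; exact: le_lorentz_integrand.
Qed.

(** The factor [l^-1] comes out of the rearrangement with power [q t]. Enlarging the base to at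
    least [1] makes powers increase with the exponent, so the bound [Q] of [q] gives one constant
    for all [t] and all [f]. *)
Lemma lorentz_modular_div l : 0 < l -> exists2 K : R, 0 < K &
  forall f, (lorentz_modular p q (fun x => f x / (l%:C)%C)%R <=
    K%:E * lorentz_modular p q f)%E.
Proof.
move=> l0; have [Q Q0 qQ] := exponent_bounded hq.
exists (Num.max 1 l^-1 `^ Q) => [|f].
  by rewrite powR_gt0// lt_max ltr01.
rewrite !lorentz_modularE -ge0_integralZl_EFin; last 4 first.
- exact: measurable_half_line.
- by move=> t _; exact: lorentz_integrand_ge0.
- exact: measurable_lorentz_integrand.
- exact: powR_ge0.
apply: ge0_le_integral.
- exact: measurable_half_line.
- by move=> t _; exact: lorentz_integrand_ge0.
- exact: measurable_lorentz_integrand.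
- apply: measurable_funeM; exact: measurable_lorentz_integrand.
move=> t /half_lineP t0; rewrite /lorentz_integrand muleCA.
apply: lee_wpmul2l; first by rewrite lee_fin powR_ge0.
have q0 := q_gt0 t0.
apply: (@le_trans _ _ (poweR (l^-1%:E * rearrangement f t) (q t))).
  apply: gt0_ler_poweR; rewrite ?in_itv/= ?rearrangement_ge0 ?leey//.
  - exact: ltW.
  - by rewrite mule_ge0 ?rearrangement_ge0// lee_fin invr_ge0 ltW.
  - exact: rearrangement_div.
rewrite poweRM ?rearrangement_ge0 ?lee_fin ?invr_ge0 ?(ltW l0)//.
apply: lee_wpmul2r; first exact: poweR_ge0.
rewrite poweR_EFin lee_fin.
apply: (@le_trans _ _ (Num.max 1 l^-1 `^ q t)).
  apply: ge0_ler_powR; rewrite ?nnegrE ?le_max ?ler01 ?lexx ?orbT//.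
  - exact: ltW.
  - by rewrite invr_ge0 ltW.
by apply: ler_powR; [rewrite le_max lexx|exact: qQ].
Qed.

(** If the level set had infinite measure, the rearrangement would be at least [s] at every [t], and
    the integrand would exceed a positive constant on the ray from [M]. *)
Lemma lorentz_level_set_lty f s : exponent_aty p <= exponent_aty q ->
  (lorentz_modular p q f < +oo)%E -> 0 < s ->
  (lebesgue_Rn (level_set f s) < +oo)%E.
Proof.
move=> hy fin s0; rewrite ltey; apply/eqP => foo.
have [Q Q0 qQ] := exponent_bounded hq.
have [M [c [M0 c0 Mc]]] := weight_bounded_below hp hq hy.
(* A base at most [1] turns [q t <= Q] into the lower bound [s1]^ Q <= s1 [^ q t]. *)
pose s1 := Num.min s 1; have s10 : 0 < s1 by rewrite lt_min s0 ltr01.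
have sub : (`[M, +oo[ : set R) `<=` @half_line R.
  move=> t; rewrite /= in_itv/= andbT => Mt; apply/half_lineP.
  exact: lt_le_trans Mt.
have cs0 : 0 < c * s1 `^ Q by rewrite mulr_gt0// powR_gt0.
suff : (+oo <= lorentz_modular p q f)%E by rewrite leNgt fin.
apply: (@le_trans _ _ (\int[@lebesgue_R R]_(t in (`[M, +oo[ : set R))
    (cst (c * s1 `^ Q)%:E : Rleb R -> \bar R) t)%E).
  rewrite integral_cst; last exact: measurable_Rleb.
  by rewrite [X in (_ * X)%E]lebesgue_R_itvcy gt0_muley ?lte_fin.
have mM : measurable ((`[M, +oo[ : set R) : set (Rleb R)).
  exact: measurable_Rleb.
apply: (@le_trans _ _ (\int[@lebesgue_R R]_(t in (`[M, +oo[ : set R))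
    lorentz_integrand f t)%E).
  apply: ge0_le_integral.
  - exact: mM.
  - by move=> t _; rewrite lee_fin ltW.
  - exact: measurable_cst.
  - apply: (measurable_funS (@measurable_half_line R) sub).
    exact: measurable_lorentz_integrand.
  - move=> t tM; have /half_lineP t0 := sub _ tM.
    move: tM; rewrite /= in_itv/= andbT => Mt.
    rewrite EFinM; apply: lee_pmul; rewrite ?lee_fin ?powR_ge0 ?(ltW c0)//.
      exact: Mc.
    have sf : (s1%:E <= rearrangement f t)%E.
      apply: (@le_trans _ _ s%:E); first by rewrite lee_fin ge_min lexx.
      by apply: rearrangement_ge; rewrite foo ltry.
    apply: (@le_trans _ _ (poweR s1%:E (q t))).
      rewrite poweR_EFin lee_fin; apply: ger_powR; last exact: qQ.
      by rewrite s10/= ge_min lexx orbT.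
    apply: gt0_ler_poweR; rewrite ?in_itv/= ?rearrangement_ge0 ?leey//.
    + exact/ltW/q_gt0.
    + by rewrite lee_fin ltW.
rewrite lorentz_modularE.
apply: (@ge0_subset_integral _ _ _ (@lebesgue_R R) _ _ mM
  (@measurable_half_line R)).
- exact: measurable_lorentz_integrand.
- by move=> t _; exact: lorentz_integrand_ge0.
- exact: sub.
Qed.

Lemma lorentz_integrand_indic_cvg0 f (E : (set (Rn R n))^nat) t :
  exponent_aty p <= exponent_aty q -> lorentz_space p q f ->
  (forall j, measurable (E j)) ->
  (forall i j, (i <= j)%N -> E j `<=` E i) ->
  \bigcap_j E j = set0 -> 0 < t ->
  lorentz_integrand (fun x => f x * \1_(E j) x) t @[j --> \oo] --> 0%E.
Proof.
move=> hy [mf ff] mE decE capE t0.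
have q0 := q_gt0 t0; set w := t `^ (q t / p t - 1).
have w0 : 0 < w by exact: powR_gt0.
apply: cvge0_squeeze => [j|e e0]; first exact: lorentz_integrand_ge0.
pose s := (e / w) `^ (q t)^-1.
have s0 : 0 < s by rewrite powR_gt0// divr_gt0.
have es : e%:E = (w%:E * poweR s%:E (q t))%E.
  rewrite poweR_EFin /s -powRrM mulVf ?gt_eqF// powRr1 ?divr_ge0 ?ltW//.
  by rewrite -EFinM mulrC divfK// gt_eqF.
near=> j; rewrite es /lorentz_integrand -/w.
apply: lee_wpmul2l; first by rewrite lee_fin ltW.
apply: gt0_ler_poweR; rewrite ?in_itv/= ?rearrangement_ge0 ?leey//.
- exact: ltW.
- by rewrite lee_fin ltW.
near: j; apply: rearrangement_indic_cvg0 => // u u0.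
exact: lorentz_level_set_lty.
Unshelve. all: by end_near. Qed.

Lemma lorentz_modular_indic_cvg0 f (E : (set (Rn R n))^nat) :
  exponent_aty p <= exponent_aty q -> lorentz_space p q f ->
  (forall j, measurable (E j)) ->
  (forall i j, (i <= j)%N -> E j `<=` E i) ->
  \bigcap_j E j = set0 ->
  lorentz_modular p q (fun x => f x * \1_(E j) x) @[j --> \oo] --> 0%E.
Proof.
move=> hy ff mE decE capE.
have mH := @measurable_half_line R.
have fE t j : 0 < t -> (lorentz_integrand (fun x => (f x * \1_(E j) x)%R) t <=
    lorentz_integrand f t)%E.
  by move=> t0; apply: le_lorentz_integrand => // x; exact: normr_mul_indic.
have ig : (@lebesgue_R R).-integrable (@half_line R) (lorentz_integrand f).
  apply/integrableP; split; first exact: measurable_lorentz_integrand.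
  under eq_integral do rewrite gee0_abs ?lorentz_integrand_ge0//.
  exact: ff.2.
have mf j := measurable_lorentz_integrand (fun x => f x * \1_(E j) x).
have cf : {ae @lebesgue_R R, forall t, @half_line R t ->
    lorentz_integrand (fun x => f x * \1_(E j) x) t @[j --> \oo] --> 0%E}.
  by apply: aeW => t /half_lineP; exact: lorentz_integrand_indic_cvg0.
have domf : {ae @lebesgue_R R, forall t j, @half_line R t ->
    (`|lorentz_integrand (fun x => (f x * \1_(E j) x)%R) t| <=
      lorentz_integrand f t)%E}.
  apply: aeW => t j /half_lineP t0.
  by rewrite gee0_abs ?lorentz_integrand_ge0// fE.
(* The third conclusion is the convergence of the integrals themselves. *)
have [_ _] := dominated_convergence mH mf (measurable_cst _) cf ig domf.
by rewrite integral0; exact.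
Qed.

(** * From the modular to the norm *)

Lemma lorentz_norm_ge0 f : (0 <= lorentz_norm p q f)%E.
Proof. by apply: le_ereal_inf_tmp => _ [l [/ltW l0 _] <-]; rewrite lee_fin. Qed.

Lemma le_lorentz_norm f g : (forall x, `|f x| <= `|g x|) ->
  (lorentz_norm p q f <= lorentz_norm p q g)%E.
Proof.
move=> fg; apply: ereal_inf_le_tmp => _ [l [l0 gl] <-].
exists l; last exact: erefl.
split; first exact: l0.
apply: le_trans gl; apply: le_lorentz_modular => x.
by rewrite !normrM ler_wpM2r.
Qed.

(** To make [e] admissible in the norm, the modular of the function divided by [e] must be at most
    [1]. It is at most [K] times the undivided modular, with [K] independent of [j], so it suffices
    to wait until the latter is at most [K^-1]. *)
Lemma lorentz_norm_indic_cvg0 f (E : (set (Rn R n))^nat) :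
  exponent_aty p <= exponent_aty q -> lorentz_space p q f ->
  (forall j, measurable (E j)) ->
  (forall i j, (i <= j)%N -> E j `<=` E i) ->
  \bigcap_j E j = set0 ->
  lorentz_norm p q (fun x => f x * \1_(E j) x) @[j --> \oo] --> 0%E.
Proof.
move=> hy ff mE decE capE.
apply: cvge0_squeeze => [j|e e0]; first exact: lorentz_norm_ge0.
have [K K0 fK] := lorentz_modular_div e0.
have /fine_cvgP[fin /cvgr_le/(_ K^-1)] :=
  lorentz_modular_indic_cvg0 hy ff mE decE capE.
rewrite invr_gt0 => /(_ K0) le1.
near=> j; apply: ereal_inf_lbound; exists e; last exact: erefl.
split; first exact: e0.
apply: le_trans (fK _) _; rewrite -lee_pdivlMl// mule1.
have fj : lorentz_modular p q (fun x => f x * \1_(E j) x) \is a fin_num.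
  by near: j.
rewrite -(fineK fj) lee_fin.
by near: j.
Unshelve. all: by end_near. Qed.

End modular.

Theorem proposition11 (R : realType) (n : nat) (p q : R -> R)
    (hp : exponent_P0 p) (hq : exponent_P0 q)
    (h0 : exponent_at0 q <= exponent_at0 p)
    (hy : exponent_aty p <= exponent_aty q)
    (f : Rn R n -> R[i]) (hf : lorentz_space p q f)
    (E : (set (Rn R n))^nat)
    (mE : forall j, measurable (E j))
    (decE : forall j, E j.+1 `<=` E j)
    (capE : \bigcap_j E j = set0) :
  nonincreasing_seq (fun j => lorentz_norm p q (fun x => f x * \1_(E j) x)) /\
  lorentz_norm p q (fun x => f x * \1_(E j) x) @[j --> \oo] --> 0%E.
Proof.
have niE i j : (i <= j)%N -> E j `<=` E i.
  move=> ij; rewrite -(subnKC ij).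
  elim: (j - i)%N => [|k IH]; first by rewrite addn0.
  by rewrite addnS; apply: subset_trans IH.
split; last exact: lorentz_norm_indic_cvg0.
move=> i j ij; apply: le_lorentz_norm => // x.
rewrite !normrM ler_wpM2l// !indicE.
(* On [E j] both indicators equal one; elsewhere the left one vanishes. *)
case: (boolP (x \in E j)) => [/set_mem/(niE _ _ ij) Eix|_].
  by rewrite (mem_set Eix).
by rewrite normr0.
Qed.
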